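(* Let $\mathcal{C}$ be a binary $[n,k]$ self-dual code with $k=n/2$, and suppose that the theta series ratio of its Construction A lattice satisfies $\Delta_{\Lambda_{\mathrm A}(\mathcal{C})}(\tau)\le 1$ for all $\tau>0$. Then $$\sum_{w=0}^{n}\frac{A_w^{\mathrm{UB}}-A_w(\mathcal{C})}{w+1}\ge 0.$$
   Context: A binary $[n,k]$ code is a $k$-dimensional linear subspace $\mathcal{C}\subseteq\mathbb{F}_2^n$; it is self-dual if $\mathcal{C}=\mathcal{C}^\perp$ with respect to the standard inner product modulo $2$. $A_w(\mathcal{C})$ denotes the number of codewords of $\mathcal{C}$ of Hamming weight $w$. For $w\in\{0,\dots,n\}$, set $A_w^{\mathrm{UB}}=\binom{k}{w'}$ if $w=2w'$ with $w'\in\{0,\dots,k\}$, and $A_w^{\mathrm{UB}}=0$ otherwise. The Construction A lattice is $\Lambda_{\mathrm A}(\mathcal{C})=\frac{1}{\sqrt2}(\mathcal{C}+2\mathbb{Z}^n)$, where codewords are viewed as $0/1$ integer vectors; it has volume $1$ when $\mathcal{C}$ is self-dual. For a lattice $\Lambda$ and $\tau>0$, $\Theta_\Lambda(i\tau)=\sum_{\lambda\in\Lambda}e^{-\pi\tau\|\lambda\|^2}$, and the theta series ratio of a volume-one lattice $\Lambda\subset\mathbb{R}^n$ is $\Delta_\Lambda(\tau)=\Theta_\Lambda(i\tau)/\Theta_{\mathbb{Z}^n}(i\tau)$. *)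

(* Defs.v *)
From HB Require Import structures.
From mathcomp Require Import all_boot all_order all_algebra.
From mathcomp Require Import all_classical all_reals all_analysis.

Set Implicit Arguments.
Unset Strict Implicit.
Unset Printing Implicit Defensive.

Import Order.TTheory GRing.Theory Num.Theory.
Import numFieldNormedType.Exports.

Local Open Scope classical_set_scope.
Local Open Scope ring_scope.

Definition dual_code (n : nat) (C : {vspace 'rV['F_2]_n}) : {set 'rV['F_2]_n} :=
  [set x : 'rV['F_2]_n |
     [forall y : 'rV['F_2]_n, (y \in C) ==> (\sum_i x 0 i * y 0 i == 0)]]%SET.

Definition self_dual (n : nat) (C : {vspace 'rV['F_2]_n}) : Prop :=
  C =i dual_code C.

Definition hamming_weight (n : nat) (c : 'rV['F_2]_n) : nat :=
  #|[set i | c 0 i != 0]|%SET.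

Definition weight_count (n : nat) (C : {vspace 'rV['F_2]_n}) (w : nat) : nat :=
  #|[set c | (c \in C) && (hamming_weight c == w)]|%SET.

(* [k] is the dimension of the code, not its length. *)
Definition weight_count_UB (k w : nat) : nat :=
  if ~~ odd w && (w./2 <= k)%N then 'C(k, w./2) else 0%N.

(* [`|x|] on ['rV[R]_n] is the sup norm in MathComp-Analysis, hence this. *)
Definition sq_norm2 (R : realType) (n : nat) (x : 'rV[R]_n) : R :=
  \sum_i x 0 i ^+ 2.

Definition int_lattice (R : realType) (n : nat) : set 'rV[R]_n :=
  range (fun z : 'rV[int]_n => map_mx intr z).
Arguments int_lattice : clear implicits.

(* Goes through the representative in {0, 1} of each coordinate. *)
Definition lift01 (R : realType) (n : nat) (c : 'rV['F_2]_n) : 'rV[R]_n :=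
  \row_i (nat_of_ord (c 0 i))%:R.

Definition constructionA (R : realType) (n : nat) (C : {vspace 'rV['F_2]_n}) :
    set 'rV[R]_n :=
  [set (Num.sqrt 2)^-1 *: (lift01 R c + 2 *: z) |
     c in [set c | c \in C] & z in int_lattice R n].
Arguments constructionA R {n} C _ : assert.

(* [theta L tau] is the theta series of [L] at [i * tau]; it is an
   unconditional sum of positive terms, so it lives in [\bar R] and is finite
   for every lattice [L] and every [tau > 0]. *)
Definition theta (R : realType) (n : nat) (L : set 'rV[R]_n) (tau : R) : \bar R :=
  \esum_(x in L) (expR (- (pi * tau * sq_norm2 x)))%:E.

(* Meant for [L] of volume 1. *)
Definition theta_ratio (R : realType) (n : nat) (L : set 'rV[R]_n) (tau : R) :
    \bar R :=
  (theta L tau / theta (int_lattice R n) tau)%E.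

(* Main.v *)
Require Import Defs.
From mathcomp Require Import all_boot all_order all_algebra.
From mathcomp Require Import all_classical all_reals all_analysis.
From mathcomp Require Import lra ring zify polyrcf.

Set Implicit Arguments.
Unset Strict Implicit.
Unset Printing Implicit Defensive.

Import Order.TTheory GRing.Theory Num.Theory.
Import numFieldNormedType.Exports.

Local Open Scope classical_set_scope.
Local Open Scope ring_scope.

(** Put y = exp (- pi tau / 2) and let a(y), b(y) be the sums of y ^ (z ^ 2)
    over the even and over the odd integers z. Scaling the Construction A lattice by
    sqrt 2 turns it into the integer vectors whose reduction mod 2 lies in C;
    grouping these by their reduction c, each coordinate of c contributes one
    factor a or b, so the theta series is the weight enumerator
    \sum_(c in C) a ^ (n - wt c) * b ^ (wt c) ([theta_constructionA]). The theta
    series of Z ^ n is t ^ n with t = \sum_z y ^ (2 z ^ 2), and rotating Z ^ 2 by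
    45 degrees gives t ^ 2 = a ^ 2 + b ^ 2 ([square_series_rotation]).

    Hence the hypothesis on the ratio says, after division by a ^ n, that
    \sum_(c in C) x ^ (wt c) <= (1 + x ^ 2) ^ k at x = b(y) / a(y). Every x in
    ]0, 1[ is such a quotient ([odd_even_ratio_onto]): the quotient is continuous
    and vanishes at y = 0, and b(y) >= y * a(y) makes it at least x at y = x.

    The binomial bounds are exactly the coefficients of (1 + x ^ 2) ^ k, so the
    polynomial with coefficients A^UB_w - A_w is nonnegative on ]0, 1[, and the
    sum in the theorem is its integral over [0, 1] ([sum_div_succ_ge0]). *)

(** * Unconditional sums of nonnegative terms *)

Lemma esumZl (R : realType) (T : choiceType) (D : set T) (c : R)
    (f : T -> \bar R) :
  0 <= c -> (forall x, 0 <= f x)%E ->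
  (\esum_(x in D) (c%:E * f x) = c%:E * \esum_(x in D) f x)%E.
Proof.
rewrite le_eqVlt => /predU1P[<- f0|].
  by rewrite mul0e esum1// => x _; rewrite mul0e.
have half (r : R) (g : T -> \bar R) : 0 < r -> (forall x, 0 <= g x)%E ->
    (\esum_(x in D) (r%:E * g x) <= r%:E * \esum_(x in D) g x)%E.
  move=> r0 g0; apply: ge_ereal_sup => _ [F [finF FD]] <-.
  rewrite -ge0_mule_fsumr// lee_pmul2l ?lte_fin//.
  by apply: ereal_sup_ubound; exists F.
move=> c0 f0; apply/eqP; rewrite eq_le half//=.
rewrite -lee_pdivlMl// (le_trans _ (half _ _ _ _)) ?invr_gt0//.
  apply: le_esum => x _.
  by rewrite muleA -EFinM mulVf ?gt_eqF// mul1e.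
by move=> x; rewrite mule_ge0// lee_fin ltW.
Qed.

Lemma esum_pair (R : realType) (S T : choiceType) (A : set S) (B : set T)
    (f : S -> R) (g : T -> R) (a b : R) :
  (forall x, 0 <= f x) -> (forall y, 0 <= g y) ->
  \esum_(x in A) (f x)%:E = a%:E -> \esum_(y in B) (g y)%:E = b%:E ->
  \esum_(p in A `*` B) (f p.1 * g p.2)%:E = (a * b)%:E.
Proof.
move=> f0 g0 fa gb.
have b0 : 0 <= b by rewrite -lee_fin -gb esum_ge0// => y _; rewrite lee_fin.
transitivity (\esum_(x in A) \esum_(y in B) (f x * g y)%:E).
  rewrite esum_esum// => x y _ _.
  by rewrite lee_fin mulr_ge0.
have f0' x : (0 <= (f x)%:E)%E by rewrite lee_fin.
have g0' y : (0 <= (g y)%:E)%E by rewrite lee_fin.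
transitivity (\esum_(x in A) (b%:E * (f x)%:E)%E).
  apply: eq_esum => x _; rewrite muleC -gb -(esumZl B (f0 x) g0').
  by apply: eq_esum => y _; rewrite EFinM.
by rewrite (esumZl A b0 f0') fa -EFinM mulrC.
Qed.

(** With [k] the reduction mod 2, this is what splits a lattice sum into the
    contributions of the individual codewords. *)
Lemma esum_fibers (R : realType) (T : choiceType) (K : finType) (D : set T)
    (k : T -> K) (f : T -> \bar R) : (forall x, 0 <= f x)%E ->
  \esum_(x in D) f x
  = (\sum_(j : K) \esum_(x in D `&` [set x | k x = j]) f x)%E.
Proof.
move=> f0; under eq_bigr do rewrite esum_mkcondr.
rewrite -esum_sum; last by move=> x j _ _; case: ifP.
apply: eq_esum => x _; rewrite (bigD1 (k x))//= big1 ?adde0.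
  by rewrite ifT// inE.
move=> j jk; rewrite ifF//; apply/negbTE/negP.
by rewrite inE /= => e; case/eqP: jk.
Qed.

(** A product of one-variable sums is the sum over the product index set; the
    values [s i] are real numbers, so that finiteness is part of the claim and
    no product of extended reals appears. *)
Lemma esum_rowvec (R : realType) (n : nat) (A : 'I_n -> set int)
    (g : int -> R) (s : 'I_n -> R) :
  (forall z, 0 <= g z) ->
  (forall i, \esum_(z in A i) (g z)%:E = (s i)%:E) ->
  \esum_(v in [set v : 'rV[int]_n | forall i, A i (v 0 i)])
     (\prod_i g (v 0 i))%:E = (\prod_i s i)%:E.
Proof.
move=> g0; elim: n A s => [|n IHn] A s gs.
  have -> : [set v : 'rV[int]_0 | forall i, A i (v 0 i)] = [set 0].
    by apply/seteqP; split => v /= _; [exact: thinmx0 | case].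
  by rewrite esum_set1 !big_ord0 // lee_fin.
(* Prepending a coordinate identifies int * 'rV_n with 'rV_n.+1. *)
pose e (p : int * 'rV[int]_n) : 'rV[int]_n.+1 :=
  \row_i if unlift ord0 i is Some j then p.2 0 j else p.1.
have e0 p : e p 0 ord0 = p.1 by rewrite mxE unlift_none.
have eS p j : e p 0 (lift ord0 j) = p.2 0 j by rewrite mxE liftK.
rewrite (reindex_esum (A ord0 `*`
    [set v : 'rV[int]_n | forall i, A (lift ord0 i) (v 0 i)]) _ e).
  have P0 (v : 'rV[int]_n) : 0 <= \prod_i g (v 0 i) by apply: prodr_ge0.
  have Q := IHn _ _ (fun i => gs (lift ord0 i)).
  rewrite big_ord_recl -(esum_pair g0 P0 (gs ord0) Q).
  apply: eq_esum => p _; rewrite big_ord_recl e0.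
  by congr (_ * _)%:E; apply: eq_bigr => j _; rewrite eS.
split.
- move=> p [/= p1 p2] i.
  by case: (unliftP ord0 i) => [j|] ->; rewrite ?eS ?e0.
- move=> p q _ _ epq.
  have E i : e p 0 i = e q 0 i by rewrite epq.
  rewrite [p]surjective_pairing [q]surjective_pairing.
  congr (_, _); first by have := E ord0; rewrite !e0.
  by apply/rowP => j; have := E (lift ord0 j); rewrite !eS.
- move=> v /= Av; exists (v 0 ord0, \row_j v 0 (lift ord0 j)).
    by split=> //= i; rewrite mxE.
  apply/rowP => i; case: (unliftP ord0 i) => [j|] ->; rewrite ?eS ?e0//=.
  by rewrite mxE.
Qed.

(** * Theta series in one variable *)

(** With A the even or the odd integers and y = exp (- pi tau / 2), these are the
    Jacobi theta constants theta_3 and theta_2 of nome y ^ 4. The variable y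
    rather than tau gives a meaning to y = 0, the left endpoint to which the
    intermediate value theorem is applied. *)
Definition square_series (R : realType) (A : set int) (y : R) : R :=
  fine (\esum_(z in A) (y ^+ (`|z| ^ 2))%:E).

Definition residue_class (b : 'F_2) : set int := [set z | z%:~R = b].

Lemma esum_geometric_ltoo (R : realType) (y : R) : 0 <= y -> y < 1 ->
  (\esum_(n in [set: nat]) (y ^+ n)%:E < +oo)%E.
Proof.
move=> y0 y1; rewrite -nneseries_esumT; last first.
  by move=> n; rewrite lee_fin exprn_ge0.
have /cvgP cy : series (geometric 1 y) @ \oo --> 1 / (1 - y).
  by apply: cvg_geometric_series; rewrite ger0_norm.
rewrite (_ : (fun n => _) = EFin \o series (geometric 1 y)).
  by rewrite EFin_lim// ltry.
apply/funext => n /=; rewrite -sumEFin; apply: eq_bigr => i _.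
by rewrite /= mul1r.
Qed.

(** The exponents z ^ 2 dominate |z|, so two geometric series bound the sum. *)
Lemma square_seriesE (R : realType) (A : set int) (y : R) : 0 <= y -> y < 1 ->
  \esum_(z in A) (y ^+ (`|z| ^ 2))%:E = (square_series A y)%:E.
Proof.
move=> y0 y1; have g0 n : (0 <= (y ^+ n)%:E)%E by rewrite lee_fin exprn_ge0.
rewrite fineK// ge0_fin_numE; last exact: esum_ge0.
apply: (@le_lt_trans _ _ (\esum_(z in [set: int]) (y ^+ `|z|)%:E)).
  rewrite esum_mkcond; apply: le_esum => z _; case: ifP => _ //.
  rewrite lee_fin ler_wiXn2l ?(ltW y1)//.
  by case: `|z|%N => // m; rewrite expnS expn1 leq_pmulr.
rewrite (esumID (range Posz))// !setTI.
have -> : ~` range Posz = range Negz.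
  apply/seteqP; split => [[m|m] /= nz|z [m _ <-] [k _]//]; last by exists m.
  by case: nz; exists m.
rewrite !esum_image; [|by move=> m n _ _ []|by move=> m n _ _ []].
rewrite lte_add_pinfty ?esum_geometric_ltoo//.
apply: le_lt_trans (esum_geometric_ltoo y0 y1).
by apply: le_esum => m _; rewrite lee_fin ler_wiXn2l// ltW.
Qed.

Lemma square_series_ge0 (R : realType) (A : set int) (y : R) : 0 <= y ->
  0 <= square_series A y.
Proof.
by move=> y0; apply/fine_ge0/esum_ge0 => z _; rewrite lee_fin exprn_ge0.
Qed.

Lemma even_square_series_ge1 (R : realType) (y : R) : 0 <= y -> y < 1 ->
  1 <= square_series (residue_class 0) y.
Proof.
move=> y0 y1; rewrite -lee_fin -square_seriesE//.
have g0 n : (0 <= (y ^+ n)%:E)%E by rewrite lee_fin exprn_ge0.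
rewrite (esumID [set 0])//.
rewrite (_ : (_ `&` [set 0]) = [set 0]); last first.
  by apply/seteqP; split=> [z []|z /= ->].
by rewrite esum_set1//= expr0 leeDl// esum_ge0.
Qed.

Lemma odd_square_series0 (R : realType) :
  square_series (residue_class 1) 0 = 0 :> R.
Proof.
rewrite /square_series esum1// => z; rewrite /residue_class /= => z1.
by case: z z1 => -[|m]//=; rewrite expr0n.
Qed.

(** A power is convex, so its slope below r is at most that of its chord over
    [r, r'], which is at most r' ^ j / (r' - r). This bounds the slope without
    the factor j of the derivative, so it can be summed over all exponents by
    the series at r'. *)
Lemma exprB_le_chord (R : realType) (y z r r' : R) (j : nat) :
  0 <= y -> y <= z -> z <= r -> r < r' ->
  z ^+ j - y ^+ j <= (z - y) / (r' - r) * r' ^+ j.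
Proof.
move=> y0 yz zr rr'.
have z0 := le_trans y0 yz; have r0 := le_trans z0 zr.
have r'0 := le_trans r0 (ltW rr').
apply: (@le_trans _ _ ((z - y) / (r' - r) * (r' ^+ j - r ^+ j))); last first.
  rewrite ler_wpM2l ?gerBl ?exprn_ge0// divr_ge0 ?subr_ge0// ltW//.
rewrite !subrXX mulrA divfK ?subr_eq0 ?gt_eqF// ler_wpM2l ?subr_ge0//.
apply: ler_sum => i _; apply: ler_pM; rewrite ?exprn_ge0//.
  by rewrite lerXn2r ?nnegrE// (le_trans zr (ltW rr')).
by rewrite lerXn2r ?nnegrE// (le_trans yz zr).
Qed.

Lemma square_series_le_chord (R : realType) (A : set int) (y z r r' : R) :
  0 <= y -> y <= z -> z <= r -> r < r' -> r' < 1 ->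
  square_series A y <= square_series A z
    <= square_series A y + (z - y) / (r' - r) * square_series A r'.
Proof.
move=> y0 yz zr rr' r'1.
have z0 := le_trans y0 yz; have r0 := le_trans z0 zr.
have r'0 := le_trans r0 (ltW rr').
have z1 := le_lt_trans zr (lt_trans rr' r'1); have y1 := le_lt_trans yz z1.
have g0 (x : R) n : 0 <= x -> (0 <= (x ^+ n)%:E)%E.
  by move=> x0; rewrite lee_fin exprn_ge0.
have c0 : 0 <= (z - y) / (r' - r) by rewrite divr_ge0// subr_ge0// ltW.
apply/andP; split; rewrite -lee_fin ?EFinD ?EFinM -!square_seriesE//.
  by apply: le_esum => x _; rewrite lee_fin lerXn2r.
rewrite -(esumZl A c0); last by move=> x; apply: g0.
rewrite -esumD; last 2 first.
- by move=> x _; apply: g0.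
- by move=> x _; rewrite mule_ge0 ?lee_fin ?g0//; apply: g0.
apply: le_esum => x _.
by rewrite -EFinM -EFinD lee_fin -lerBlDl exprB_le_chord.
Qed.

(** Summing the chord bound over the exponents makes the series Lipschitz on
    [0, r], with the series at some r' in ]r, 1[ entering the constant. *)
Lemma continuous_square_series (R : realType) (A : set int) (r : R) : r < 1 ->
  {within `[0, r], continuous (square_series A)}.
Proof.
move=> r1; apply/subspace_continuousP => x.
rewrite /= in_itv /= => /andP[x0 xr].
have [r' /andP[rr' r'1]] : exists r', r < r' < 1.
  by exists ((r + 1) / 2); rewrite !midf_lt.
have r'0 : 0 <= r' by rewrite (le_trans x0)// (le_trans xr)// ltW.
pose K := square_series A r' / (r' - r) + 1.
have K0 : 0 < K.
  by rewrite ltr_wpDl// divr_ge0 ?subr_ge0 ?(ltW rr')// square_series_ge0.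
have lip y z : 0 <= y -> y <= z -> z <= r ->
    `|square_series A z - square_series A y| <= K * (z - y).
  move=> y0 yz zr.
  have /andP[h1 h2] := square_series_le_chord A y0 yz zr rr' r'1.
  rewrite ger0_norm ?subr_ge0//; rewrite /K.
  have := subr_ge0 y z; rewrite yz => zy0.
  move: h2; rewrite [_ / _ * _]mulrAC; nra.
apply/cvgrPdist_le => e e0; rewrite near_withinE; near=> t.
rewrite /= in_itv /= => /andP[t0 tr].
have : K * `|x - t| <= e.
  rewrite -ler_pdivlMl// mulrC; near: t.
  by apply: cvgr_dist_le => //; rewrite divr_gt0.
have [xt|/ltW tx] := leP x t; apply: le_trans.
  by rewrite distrC (le_trans (lip _ _ _ _ _))// distrC ger0_norm// subr_ge0.
by rewrite (le_trans (lip _ _ _ _ _))// ger0_norm// subr_ge0.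
Unshelve. all: by end_near. Qed.

(** Shifting the even integers by 1 and by -1 gives the odd sum twice. Since
    (z + 1) ^ 2 + (z - 1) ^ 2 = 2 (z ^ 2 + 1), the arithmetic-geometric mean
    inequality bounds each pair of shifted terms from below by
    2 y * y ^ (z ^ 2). With this bound no asymptotics of the two series as y
    tends to 1 are called for. *)
Lemma odd_square_series_ge (R : realType) (y : R) : 0 <= y -> y < 1 ->
  y * square_series (residue_class 0) y <= square_series (residue_class 1) y.
Proof.
move=> y0 y1.
have g0 n : (0 <= (y ^+ n)%:E)%E by rewrite lee_fin exprn_ge0.
have shift (d : int) : d%:~R = 1 :> 'F_2 ->
    \esum_(z in residue_class 0) (y ^+ (`|z + d| ^ 2))%:E =
    (square_series (residue_class 1) y)%:E.
  move=> d1; rewrite -square_seriesE//.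
  apply/esym/(@reindex_esum _ _ _ _ _ (fun z => z + d)
    (fun z => (y ^+ (`|z| ^ 2))%:E)).
  split.
  - by move=> z; rewrite /residue_class /= rmorphD /= d1 => ->; rewrite add0r.
  - by move=> z z' _ _ /addIr.
  - move=> z; rewrite /residue_class /= => z1.
    by exists (z - d); rewrite ?subrK//= rmorphB /= z1 d1 subrr.
suff : ((y + y) * square_series (residue_class 0) y <=
    square_series (residue_class 1) y + square_series (residue_class 1) y).
  lra.
rewrite -lee_fin EFinM [leRHS]EFinD -{1}(shift 1)// -(shift (-1)); last first.
  exact/val_inj.
rewrite -square_seriesE// -esumD// -esumZl//; last by rewrite addr_ge0.
apply: le_esum => z _; rewrite -EFinM -EFinD lee_fin.
set p := y ^+ _; set q := y ^+ _; set s := y ^+ _.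
have p0 : 0 <= p by exact: exprn_ge0.
have q0 : 0 <= q by exact: exprn_ge0.
have s0 : 0 <= s by exact: exprn_ge0.
have pq : q * s = (y * p) ^+ 2.
  by rewrite -exprS -exprM -exprD; congr (_ ^+ _); lia.
rewrite -(@ler_pXn2r _ 2) ?nnegrE ?mulr_ge0 ?addr_ge0//.
have := sqr_ge0 (q - s); nra.
Qed.

(** Intermediate value theorem on [0, x] for odd - x * even: it is negative at 0,
    where only the even sum survives, and nonnegative at x by
    [odd_square_series_ge]. *)
Lemma odd_even_ratio_onto (R : realType) (x : R) : 0 < x -> x < 1 ->
  exists2 y, 0 < y < 1 &
    square_series (residue_class 1) y = x * square_series (residue_class 0) y.
Proof.
move=> x0 x1.
pose h y := square_series (residue_class 1) y
  - x * square_series (residue_class 0) y.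
have h0 : h 0 < 0.
  rewrite /h odd_square_series0 sub0r oppr_lt0 mulr_gt0//.
  exact: lt_le_trans ltr01 (even_square_series_ge1 _ _).
have hx : 0 <= h x by rewrite subr_ge0 odd_square_series_ge// ltW.
have ch : {within `[0, x], continuous h}.
  move=> t; apply: cvgB; first exact: continuous_square_series.
  by apply: cvgM; [exact: cvg_cst | exact: continuous_square_series].
have [|y] := IVT (ltW x0) ch (v := 0).
  by rewrite ge_min le_max hx (ltW h0) orbT.
rewrite in_itv /= => /andP[y0 yx] hy; exists y; last first.
  by apply/eqP; rewrite -subr_eq0; apply/eqP.
rewrite (le_lt_trans yx x1) andbT lt_neqAle y0 andbT.
by apply: contraTneq h0 => y_eq0; rewrite -leNgt y_eq0 hy -y_eq0.
Qed.

(** * Theta series of the lattices *)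

Lemma intr_F2_decomp (z : int) :
  exists m : int, z = (nat_of_ord (z%:~R : 'F_2))%:Z + 2 * m.
Proof.
exists (z %/ 2)%Z; rewrite {1}(divz_eq z 2) addrC mulrC; congr (_ + _).
have z2 : (z%:~R : 'F_2) = ((z %% 2)%Z)%:~R.
  rewrite {1}(divz_eq z 2) rmorphD rmorphM /= (_ : 2%:~R = 0 :> 'F_2).
    by rewrite mulr0 add0r.
  exact/val_inj.
rewrite z2; have : (0 <= (z %% 2)%Z < 2)%R by rewrite modz_ge0// ltz_pmod.
by case: (z %% 2)%Z => -[|[|m]].
Qed.

(** The map (u, v) -> (u + v, u - v) sends Z ^ 2 onto the pairs (s, d) with s and
    d of the same parity, and 2 u ^ 2 + 2 v ^ 2 = s ^ 2 + d ^ 2. Both coordinates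
    even gives the first square on the right, both odd the second. *)
Lemma square_series_rotation (R : realType) (y : R) : 0 <= y -> y < 1 ->
  square_series setT (y ^+ 2) ^+ 2 =
  square_series (residue_class 0) y ^+ 2
  + square_series (residue_class 1) y ^+ 2.
Proof.
move=> y0 y1; have yy0 : 0 <= y ^+ 2 by rewrite exprn_ge0.
have yy1 : y ^+ 2 < 1 by rewrite expr_lt1.
have g0 (x : R) : 0 <= x -> forall z : int, 0 <= x ^+ (`|z| ^ 2).
  by move=> x0 z; rewrite exprn_ge0.
pose D := [set p : int * int | p.1%:~R = p.2%:~R :> 'F_2].
pose e (p : int * int) := (p.1 + p.2, p.1 - p.2).
have bij_e : set_bij (setT `*` setT) D e.
  split.
  - move=> p _; rewrite /D /= rmorphD rmorphB /=; congr (_ + _).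
    by case: ((p.2)%:~R : 'F_2) => -[|[|m]] m2 //; apply: val_inj.
  - move=> [u v] [u' v'] _ _ [/= h1 h2]; congr (_, _); lia.
  - move=> [s d] /= sd.
    have [m sdm] := intr_F2_decomp (s - d).
    have sd0 : (s - d)%:~R = 0 :> 'F_2 by rewrite rmorphB /= sd subrr.
    rewrite sd0 add0r in sdm.
    by exists (d + m, m) => //; rewrite /e /=; congr (_, _); lia.
apply/EFin_inj; rewrite expr2.
rewrite -(esum_pair (g0 _ yy0) (g0 _ yy0) (square_seriesE setT yy0 yy1)
  (square_seriesE setT yy0 yy1)).
transitivity (\esum_(p in D) (y ^+ (`|p.1| ^ 2) * y ^+ (`|p.2| ^ 2))%:E).
  rewrite (reindex_esum _ _ _ _ bij_e); apply: eq_esum => p _; congr (_%:E).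
  rewrite /= -!exprM -!exprD; congr (_ ^+ _); lia.
rewrite (esum_fibers D (fun p : int * int => p.1%:~R : 'F_2)); last first.
  by move=> p; rewrite lee_fin mulr_ge0// g0.
rewrite (eq_bigr (fun j =>
    (square_series (residue_class j) y ^+ 2)%:E)); last first.
  move=> j _; rewrite expr2.
  rewrite -(esum_pair (g0 _ y0) (g0 _ y0)
    (square_seriesE (residue_class j) y0 y1)
    (square_seriesE (residue_class j) y0 y1)).
  congr esum; apply/seteqP; split => p; rewrite /D /residue_class /=.
    by move=> [<- <-].
  by move=> [-> ->].
rewrite sumEFin; congr (_%:E).
rewrite !big_ord_recl big_ord0 addr0.
by congr (square_series (residue_class _) y ^+ 2
  + square_series (residue_class _) y ^+ 2); apply/val_inj.
Qed.

Lemma sq_norm2_int (R : realType) (n : nat) (v : 'rV[int]_n) :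
  sq_norm2 (map_mx intr v : 'rV[R]_n) = (\sum_i `|v 0%R i| ^ 2)%N%:R.
Proof.
rewrite natr_sum; apply: eq_bigr => i _.
by rewrite mxE natrX natr_absz intr_norm real_normK// num_real.
Qed.

Lemma sq_norm2Z (R : realType) (n : nat) (c : R) (x : 'rV[R]_n) :
  sq_norm2 (c *: x) = c ^+ 2 * sq_norm2 x.
Proof.
by rewrite /sq_norm2 mulr_sumr; apply: eq_bigr => i _; rewrite mxE exprMn.
Qed.

(** The inverse of tau -> exp (- pi tau / 2): the factor 1 / 2 matches the scaling
    by 1 / sqrt 2 in Construction A, so that vectors of that lattice contribute
    natural powers of y. *)
Definition tau_of_base (R : realType) (y : R) : R := - (2 * ln y) / pi.

Lemma gaussian_base (R : realType) (y : R) (N : nat) : 0 < y ->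
  expR (- (pi * tau_of_base y * (N%:R / 2))) = y ^+ N.
Proof.
move=> y0; rewrite (_ : - _ = N%:R * ln y); first by rewrite expRM_natl lnK.
have := pi_gt0 R; rewrite /tau_of_base; move: (pi) => p p0.
by field; rewrite gt_eqF.
Qed.

Lemma map_intr_inj (R : realType) (n : nat) :
  injective (fun v : 'rV[int]_n => map_mx intr v : 'rV[R]_n).
Proof.
move=> u v /rowP uv; apply/rowP => i.
by have := uv i; rewrite !mxE => /intr_inj.
Qed.

(** Without the scaling by 1 / sqrt 2 the base of the powers is
    y ^ 2 = exp (- pi tau). *)
Lemma theta_int_lattice (R : realType) (n : nat) (y : R) : 0 < y -> y < 1 ->
  theta (int_lattice R n) (tau_of_base y)
  = (square_series setT (y ^+ 2) ^+ n)%:E.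
Proof.
move=> y0 y1; have yy0 : 0 <= y ^+ 2 by rewrite exprn_ge0 ?ltW.
have yy1 : y ^+ 2 < 1 by rewrite expr_lt1 ?ltW.
rewrite /theta /int_lattice esum_image; last first.
  by move=> u v _ _ /map_intr_inj.
have g0 (z : int) : 0 <= (y ^+ 2) ^+ (`|z| ^ 2) by rewrite exprn_ge0.
rewrite -[n in RHS]card_ord -prodr_const.
rewrite -(esum_rowvec g0 (fun _ : 'I_n => square_seriesE setT yy0 yy1)).
rewrite (_ : [set v : 'rV[int]_n | _] = setT); last first.
  by apply/seteqP; split.
apply: eq_esum => v _; congr (_%:E).
rewrite sq_norm2_int -expr_sum -(exprM _ 2) -gaussian_base//.
by congr (expR (- (_ * _))); rewrite natrM; field.
Qed.

(** Construction A as a rescaled set of integer vectors, indexed injectively: a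
    pair (c, z) is the same as a vector with reduction c, by division by 2. *)
Lemma constructionA_int (R : realType) (n : nat) (C : {vspace 'rV['F_2]_n}) :
  constructionA R C = (fun v : 'rV[int]_n => (Num.sqrt 2)^-1 *: map_mx intr v)
    @` [set v | (map_mx intr v : 'rV['F_2]_n) \in C].
Proof.
apply/seteqP; split => [_ [c /= Cc] [_ [z _ <-] <-]|_ [v /= Cv <-]].
  exists (\row_i ((nat_of_ord (c 0 i))%:Z + 2 * z 0 i)).
    rewrite (_ : map_mx _ _ = c)//; apply/rowP => i.
    rewrite !mxE rmorphD rmorphM /=.
    rewrite (_ : 2%:~R = 0 :> 'F_2) ?mul0r ?addr0; last exact/val_inj.
    exact: natr_Zp.
  by congr (_ *: _); apply/rowP => i; rewrite !mxE rmorphD rmorphM.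
have /choice [m vm] : forall i, exists m : int,
    v 0 i = (nat_of_ord ((v 0 i)%:~R : 'F_2))%:Z + 2 * m.
  by move=> i; apply: intr_F2_decomp.
exists (map_mx intr v) => //.
exists (map_mx intr (\row_i m i)); first by exists (\row_i m i).
by congr (_ *: _); apply/rowP => i; rewrite !mxE [in RHS]vm rmorphD rmorphM.
Qed.

Lemma theta_constructionA (R : realType) (n : nat) (C : {vspace 'rV['F_2]_n})
    (y : R) : 0 < y -> y < 1 ->
  theta (constructionA R C) (tau_of_base y)
  = (\sum_(c in C) \prod_i square_series (residue_class (c 0 i)) y)%:E.
Proof.
move=> y0 y1; have g0 (z : int) : 0 <= y ^+ (`|z| ^ 2).
  by rewrite exprn_ge0 ?ltW.
rewrite /theta constructionA_int esum_image; last first.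
  move=> u v _ _ /scalerI uv; apply/(@map_intr_inj R)/uv.
  by rewrite invr_eq0 sqrtr_eq0 -ltNge.
rewrite (eq_esum (b := fun v : 'rV[int]_n =>
    (\prod_i y ^+ (`|v 0 i| ^ 2))%:E)); last first.
  move=> v _; congr (_%:E).
  rewrite sq_norm2Z sq_norm2_int exprVn sqr_sqrtr//.
  by rewrite -expr_sum -gaussian_base// [2^-1 * _]mulrC.
rewrite (esum_fibers _ (fun v => map_mx intr v : 'rV['F_2]_n)); last first.
  by move=> v; rewrite lee_fin prodr_ge0.
rewrite -sumEFin [RHS]big_mkcond; apply: eq_bigr => c _; case: ifPn => Cc.
  rewrite -(esum_rowvec g0 (fun i =>
    square_seriesE (residue_class (c 0 i)) (ltW y0) y1)).
  congr esum; apply/seteqP; split => v /=.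
    by move=> [_ <-] i; rewrite /residue_class /= mxE.
  move=> vc; have -> : map_mx intr v = c by apply/rowP => i; rewrite mxE vc.
  by [].
rewrite (_ : _ `&` _ = set0) ?esum_set0//.
by apply/seteqP; split => // v /= [Cv vc]; rewrite -vc Cv in Cc.
Qed.

(** * Weight enumerators *)

(** The sum in the conclusion is the value at 1 of an antiderivative that
    vanishes at 0 and, by the mean value theorem, is nondecreasing on [0, 1]. *)
Lemma sum_div_succ_ge0 (R : rcfType) (m : nat) (u : nat -> R) :
  (forall x, 0 < x < 1 -> 0 <= \sum_(0 <= w < m) u w * x ^+ w) ->
  0 <= \sum_(0 <= w < m) u w / w.+1%:R.
Proof.
move=> u_ge0; pose P := \sum_(0 <= w < m) (u w / w.+1%:R) *: 'X^(w.+1).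
have P0 : P.[0] = 0.
  by rewrite horner_sum big1 // => w _; rewrite hornerZ hornerXn expr0n mulr0.
have P1 : P.[1] = \sum_(0 <= w < m) u w / w.+1%:R.
  rewrite horner_sum; apply: eq_bigr => w _.
  by rewrite hornerZ hornerXn expr1n mulr1.
have dP x : P^`().[x] = \sum_(0 <= w < m) u w * x ^+ w.
  rewrite raddf_sum horner_sum; apply: eq_bigr => w _.
  rewrite /= derivZ derivXn hornerZ hornerMn hornerXn mulrnAr.
  by rewrite -mulrnAl -(mulr_natr (u w / _)) divfK ?pnatr_eq0.
rewrite -P1 -P0; apply: (@ler_hornerW _ 0 1); rewrite ?in_itv /= ?lexx ?ler01//.
by move=> x; rewrite in_itv /= => x01; rewrite dP u_ge0.
Qed.

Lemma weight_count_UB_enum (R : comNzRingType) (k : nat) (x : R) :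
  \sum_(0 <= w < (2 * k).+1) (weight_count_UB k w)%:R * x ^+ w
  = (1 + x ^+ 2) ^+ k.
Proof.
rewrite exprDn; under [RHS]eq_bigr do rewrite expr1n mul1r -exprM.
have UB_even w : weight_count_UB k w.*2 = 'C(k, w).
  by rewrite /weight_count_UB odd_double doubleK; case: leqP => //= /bin_small.
have UB_odd w : weight_count_UB k w.*2.+1 = 0%N.
  by rewrite /weight_count_UB /= odd_double.
have E m : \sum_(0 <= w < (2 * m).+1) (weight_count_UB k w)%:R * x ^+ w
    = \sum_(0 <= j < m.+1) 'C(k, j)%:R * x ^+ j.*2.
  (* Each step adds one odd weight, which contributes 0, and one even weight. *)
  elim: m => [|m IHm]; first by rewrite muln0 !big_nat1 (UB_even 0%N).
  rewrite mulnS !addSn add0n big_nat_recr//= big_nat_recr//= IHm.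
  rewrite [RHS]big_nat_recr//=.
  by rewrite mul2n UB_odd -doubleS UB_even mul0r addr0.
rewrite E big_mkord; apply: eq_bigr => j _.
by rewrite mul2n mulr_natl.
Qed.

Lemma hamming_weight_le (n : nat) (c : 'rV['F_2]_n) : (hamming_weight c <= n)%N.
Proof. by rewrite (leq_trans (max_card _)) ?card_ord. Qed.

Lemma weight_count_enum (R : pzSemiRingType) (n : nat)
    (C : {vspace 'rV['F_2]_n}) (x : R) :
  \sum_(c in C) x ^+ hamming_weight c
  = \sum_(0 <= w < n.+1) (weight_count C w)%:R * x ^+ w.
Proof.
rewrite big_mkord.
rewrite (partition_big (fun c => inord (hamming_weight c) : 'I_n.+1) predT)//=.
apply: eq_bigr => w _.
rewrite mulr_natl -sumr_const; apply: eq_big => [c|c /andP[_ /eqP <-]].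
  by rewrite inE -val_eqE /= inordK ?ltnS ?hamming_weight_le.
by rewrite inordK ?ltnS ?hamming_weight_le.
Qed.

(** Where b = x * a, every nonzero coordinate of c contributes a factor x besides
    the common factor a. *)
Lemma prod_residue_class (R : realType) (n : nat) (c : 'rV['F_2]_n) (x y : R) :
  square_series (residue_class 1) y = x * square_series (residue_class 0) y ->
  \prod_i square_series (residue_class (c 0 i)) y
  = square_series (residue_class 0) y ^+ n * x ^+ hamming_weight c.
Proof.
move=> ba.
rewrite (eq_bigr (fun i => square_series (residue_class 0) y *
    (if c 0 i != 0 then x else 1))).
  rewrite big_split prodr_const card_ord; congr (_ * _).
  rewrite -big_mkcond prodr_const; congr (_ ^+ _).
  by apply: eq_card => i; rewrite inE.
move=> i _; case: ifPn => [|/negPn/eqP ->]; last by rewrite mulr1.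
rewrite mulrC -ba => ci; congr square_series; congr residue_class.
by move: ci; case: (c 0 i) => -[|[|j]] // j2 _; apply: val_inj.
Qed.

(** At the y whose ratio of odd to even sums is x, both theta series have the
    factor a ^ n, and the bound on their quotient becomes a bound between
    polynomials in x. *)
Lemma weight_enum_le (R : realType) (n k : nat) (C : {vspace 'rV['F_2]_n})
    (x : R) : n = (2 * k)%N ->
  (forall tau : R, 0 < tau -> (theta_ratio (constructionA R C) tau <= 1)%E) ->
  0 < x < 1 -> \sum_(c in C) x ^+ hamming_weight c <= (1 + x ^+ 2) ^+ k.
Proof.
move=> n2k ratio_le1 /andP[x0 x1].
have [y /andP[y0 y1] ba] := odd_even_ratio_onto x0 x1.
have a1 := even_square_series_ge1 (ltW y0) y1.
have tau0 : 0 < tau_of_base y.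
  by rewrite divr_gt0 ?pi_gt0// oppr_gt0 pmulr_rlt0// ln_lt0// y0.
set a := square_series (residue_class 0) y in ba a1.
have a0 : 0 < a by exact: lt_le_trans a1.
have theta_Zn : square_series setT (y ^+ 2) ^+ n = a ^+ n * (1 + x ^+ 2) ^+ k.
  rewrite n2k !exprM square_series_rotation ?(ltW y0)// ba -/a -exprMn.
  by congr (_ ^+ _); ring.
have theta_C : theta (constructionA R C) (tau_of_base y)
    = (a ^+ n * \sum_(c in C) x ^+ hamming_weight c)%:E.
  rewrite theta_constructionA// mulr_sumr; congr (_%:E).
  by apply: eq_bigr => c _; rewrite (prod_residue_class c ba).
have t0 : 0 < a ^+ n * (1 + x ^+ 2) ^+ k.
  by rewrite mulr_gt0 ?exprn_gt0// addr_gt0 ?exprn_gt0.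
have := ratio_le1 _ tau0.
rewrite /theta_ratio theta_C theta_int_lattice// theta_Zn.
rewrite inver gt_eqF// lee_pdivrMr// mul1e lee_fin ler_pM2l// exprn_gt0//.
Qed.

Theorem theorem4 (R : realType) (n k : nat) (C : {vspace 'rV['F_2]_n})
  (dimC : \dim C = k) (n2k : n = (2 * k)%N) (sdC : self_dual C)
  (ratio_le1 : forall tau : R, 0 < tau ->
     (theta_ratio (constructionA R C) tau <= 1)%E) :
  0 <= \sum_(0 <= w < n.+1)
         ((weight_count_UB k w)%:R - (weight_count C w)%:R) / (w.+1)%:R :> R.
Proof.
apply: sum_div_succ_ge0 => x x01.
under eq_bigr do rewrite mulrBl.
rewrite sumrB subr_ge0 -weight_count_enum.
rewrite (le_trans (weight_enum_le n2k ratio_le1 x01))//.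
by rewrite n2k weight_count_UB_enum.
Qed.
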